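(* Let $n=p^2$ where $p$ is prime. Let $\mathcal{C}$ be the code obtained from $\mathcal{C}(r=p,p,S=\{0,1,2,3,4\})$ by appending one global parity bit equal to the sum modulo 2 of all $n$ information bits. Then $\mathcal{C}$ is a binary $5$-batch code of dimension $n$ with redundancy $5p+1=\Theta(\sqrt n)$, and therefore $r_B(n,5)=\Theta(\sqrt n)$.
   Context: Array construction: for positive integers $r,p$ with $n=rp$ and $S=\{s_0<\dots<s_{k-1}\}\subseteq\{0,\dots,p-1\}$, let $D_{s,t}=\{(i,\langle t+is\rangle_p): i=0,\dots,r-1\}$ for $s,t\in\{0,\dots,p-1\}$, where $\langle x\rangle_p=x\bmod p$. An information vector $\boldsymbol{x}\in\{0,1\}^n$ is written as an array $(x_{i,j})$, $(i,j)\in\{0,\dots,r-1\}\times\{0,\dots,p-1\}$, and redundancy bits $\rho_{\ell,t}=\sum_{(i,j)\in D_{s_\ell,t}}x_{i,j}\pmod2$ are added for $\ell\in\{0,\dots,k-1\}$, $t\in\{0,\dots,p-1\}$; $\mathcal{C}(r,p,S)$ is the binary code of all words $(\boldsymbol{x},(\rho_{\ell,t}))$. A binary linear code of length $N$ encoding $n$ information bits is a $k$-batch code if for every multiset $\{i_1,\dots,i_k\}$ of information indices there exist $k$ mutually disjoint sets $R_1,\dots,R_k$ of coordinates such that $x_{i_j}$ is a function of the codeword bits indexed by $R_j$; its redundancy is $N-n$, and $r_B(n,k)$ is the minimum redundancy of a binary $k$-batch code of dimension $n$. *)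

(* Defs.v *)
From HB Require Import structures.
From Stdlib Require Import Reals.
From mathcomp Require Import all_boot all_order all_algebra.
From mathcomp Require Import boolp.
From mathcomp Require Import Rstruct.

Set Implicit Arguments.
Unset Strict Implicit.
Unset Printing Implicit Defensive.

Import Order.TTheory GRing.Theory Num.Theory.
Local Open Scope ring_scope.

(* A binary linear code of length N encoding n information bits is given by a
   generator matrix G over F_2 of rank n; the information vector x (a row
   vector of length n) is encoded as the codeword x *m G. *)

Definition recovers (n N : nat) (G : 'M['F_2]_(n, N)) (R : {set 'I_N})
    (i : 'I_n) : Prop :=
  forall x y : 'rV['F_2]_n,
    (forall c, c \in R -> (x *m G) 0 c = (y *m G) 0 c) -> x 0 i = y 0 i.

(* k-batch property: every multiset {i_1,...,i_k} of information indices
   (given as a map 'I_k -> 'I_n) admits k mutually disjoint recovery sets. *)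
Definition batch_property (n N k : nat) (G : 'M['F_2]_(n, N)) : Prop :=
  forall req : 'I_k -> 'I_n,
  exists R : 'I_k -> {set 'I_N},
    (forall j1 j2 : 'I_k, j1 != j2 -> [disjoint R j1 & R j2]) /\
    (forall j : 'I_k, recovers G (R j) (req j)).

Definition batch_code (n N k : nat) (G : 'M['F_2]_(n, N)) : Prop :=
  \rank G = n /\ batch_property k G.

Definition achievable_redundancy (n k r : nat) : Prop :=
  exists G : 'M['F_2]_(n, n + r), batch_code k G.

(* r_B(n,k): minimum redundancy of a binary k-batch code of dimension n
   (0 by convention if no such code existed, which never happens). *)
Definition rB (n k : nat) : nat :=
  match pselect (exists r, `[< achievable_redundancy n k r >]) with
  | left h => ex_minn h
  | right _ => 0%N
  end.

Definition in_D (p s t i j : nat) : bool := (j == (t + i * s) %% p)%N.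

(* The code C(r = p, p, S = {0,1,2,3,4}) extended by a global parity bit.
   Information bit x_{i,j} (0 <= i, j < p) is coordinate i*p + j.
   Codeword coordinates: 0 .. p*p-1 : information bits;
   p*p + l*p + t (l < 5, t < p) : rho_{l,t} = parity over D_{s_l,t}, s_l = l;
   p*p + 5*p : global parity of all information bits. *)
Definition batchG (p : nat) : 'M['F_2]_(p * p, p * p + 5 * p + 1) :=
  \matrix_(a < p * p, c < p * p + 5 * p + 1)
    if (c < p * p)%N then (if (a : nat) == (c : nat) then 1 else 0)
    else if (c < p * p + 5 * p)%N then
      (if in_D p ((c - p * p) %/ p)%N ((c - p * p) %% p)%N (a %/ p)%N (a %% p)%N
       then 1 else 0)
    else 1.

Definition Theta_sqrt (f : nat -> nat) : Prop :=
  exists c1 c2 : R, 0 < c1 /\ 0 < c2 /\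
    exists N0 : nat, forall n : nat, (N0 <= n)%N ->
      c1 * Num.sqrt (n%:R) <= (f n)%:R /\ (f n)%:R <= c2 * Num.sqrt (n%:R).

(* Main.v *)
(* The information bits are points of a net: each of the five slopes partitions
   them into lines, and two lines of different slopes meet in exactly one point.
   Summing the parities of a family of lines recovers a bit q as soon as q is
   covered an odd number of times, the other bits read being those covered an odd
   number of times.  One request of each point is answered by its own bit, and
   the repeated requests by families of lines that share no line and no other
   point.  A single repeated point uses distinct slopes avoiding the other
   requests, two doubled points use parallel lines, and a request 3P + 2Q uses
   two lines through P and a triangle through Q.  The array is a net as soon as
   gcd(p, 6) = 1, so shortened codes with p = 6k + 7 give the upper bound on
   r_B(n, 5) without Bertrand's postulate.

   For the lower bound, three disjoint recovery vectors u1, u2, u3 of a bit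
   satisfy u1 = (u1 + u2)(u1 + u3) entrywise, so u1 is in the span of the at most
   r^2 products of two basis vectors of the dual code, which has dimension r; the
   vectors u1 of the n bits are linearly independent, hence n <= r^2. *)

Require Import Defs.
From HB Require Import structures.
From Stdlib Require Import Reals.
From mathcomp Require Import all_boot all_order all_algebra.
From mathcomp Require Import Rstruct.
From mathcomp Require Import boolp.
From mathcomp Require Import zify ring.

Set Implicit Arguments.
Unset Strict Implicit.
Unset Printing Implicit Defensive.

Import Order.TTheory GRing.Theory Num.Theory.

(** * Recovery families in a net with five slopes *)

Section Net.

Variables (T : finType) (Z : eqType) (f : 'I_5 -> T -> Z).

Hypothesis net_inj : forall s t u v,
  s != t -> f s u = f s v -> f t u = f t v -> u = v.
Hypothesis net_ex : forall s t x y, s != t -> exists u, f s u = x /\ f t u = y.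

(** This is the coefficient of the bit [u] in the sum over F_2 of the parities of the lines in
    [F]. *)
Definition covers (F : seq ('I_5 * Z)) (u : T) : bool :=
  odd (count (fun l => f l.1 u == l.2) F).

Definition line (s : 'I_5) (u : T) : seq ('I_5 * Z) := [:: (s, f s u)].

(** The points [q] and [q'] are exempt because coverage of requested points is controlled
    separately, by the first clause of [net_families]. *)
Definition compatible (q q' : T) (F F' : seq ('I_5 * Z)) : Prop :=
  (forall l, l \in F -> l \notin F') /\
  (forall u, u != q -> u != q' -> ~~ (covers F u && covers F' u)).

Lemma compatible_sym q q' F F' :
  compatible q q' F F' -> compatible q' q F' F.
Proof.
move=> [FF' cov]; split=> [l lF'|u uq uq']; last by rewrite andbC cov.
by apply/negP=> /FF'; rewrite lF'.
Qed.

Lemma covers_line s u v : covers (line s u) v = (f s v == f s u).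
Proof. by rewrite /covers /= addn0 oddb. Qed.

Lemma compatible_lines s t u : s != t -> compatible u u (line s u) (line t u).
Proof.
move=> st; split=> [l|v vu _]; first by rewrite !inE => /eqP ->; rewrite xpair_eqE (negPf st).
rewrite !covers_line; apply/negP=> /andP[/eqP e1 /eqP e2].
by rewrite (net_inj st e1 e2) eqxx in vu.
Qed.

Lemma compatible_parallel s u v :
  f s u != f s v -> compatible u v (line s u) (line s v).
Proof.
move=> uv; split=> [l|w _ _]; first by rewrite !inE => /eqP ->; rewrite xpair_eqE eqxx.
by rewrite !covers_line; apply/negP=> /andP[/eqP -> ]; apply/negP.
Qed.

(** A point other than [u] lies on at most one line through [u], so choosing a point of [A] on each
    line that is hit gives an injection from slopes to [A]. *)
Lemma card_slopes_hitting (A : {set T}) (u : T) : u \notin A ->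
  #|[set s | [exists d in A, f s d == f s u]]| <= #|A|.
Proof.
move=> uA; set B := [set s | _].
pose g s := odflt u [pick d in A | f s d == f s u].
have gP s : s \in B -> g s \in A /\ f s (g s) = f s u.
  rewrite inE /g => /existsP[d dP]; case: pickP => [e /andP[eA /eqP]|/(_ d)] //=.
  by rewrite dP.
rewrite -(@card_in_imset _ _ g B) => [|s t /gP[sA es] /gP[_ et] st].
  by apply/subset_leq_card/subsetP => _ /imsetP[s /gP[sA _] ->].
apply/eqP/negP => /negP nst; move/negP: uA; apply.
by rewrite -(net_inj nst es) // st.
Qed.

(* With X on the line of slope [a] through [q] and of slope [b] through [u], and Y
   on the line of slope [a] through [u], the family consists of the sides of a
   triangle XYZ, where XZ has slope [a] and YZ has slope [b].  A line of slope [a]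
   or [b] through [u] meets the sides only in Y or X, a vertex, covered twice. *)
Lemma triangle_family (a b : 'I_5) (u q : T) : a != b ->
  f a u != f a q -> f b u != f b q ->
  exists F, [/\ covers F q, ~~ covers F u,
    compatible u q (line a u) F & compatible u q (line b u) F].
Proof.
move=> ab au bu.
have [X [Xa Xb]] := net_ex (f a q) (f b u) ab.
(* Two candidates for the third slope suffice: if both put Y on the line of slope [b] through [q],
   they give the same Y, which shares two lines with X and so equals X, contradicting [au]. *)
have [c [Y [ca cb Yc Ya Yb]]] : exists c Y,
    [/\ c != a, c != b, f c Y = f c X, f a Y = f a u & f b Y != f b q].
  have : 1 < #|~: [set a; b]| by rewrite -(leq_add2l #|[set a; b]|) cardsC cards2 ab card_ord.
  case/card_gt1P => c [c' []]; rewrite !inE !negb_or => /andP[ca cb] /andP[c'a c'b] cc'.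
  have [Y [Yc Ya]] := net_ex (f c X) (f a u) ca.
  have [Y' [Yc' Ya']] := net_ex (f c' X) (f a u) c'a.
  case: (eqVneq (f b Y) (f b q)) => [e|ne]; last by exists c, Y.
  case: (eqVneq (f b Y') (f b q)) => [e'|ne]; last by exists c', Y'.
  have eY : Y = Y' by apply: (net_inj ab); rewrite ?Ya ?e.
  rewrite -eY in Yc'.
  by move: au; rewrite -Xa -Ya (net_inj cc' Yc Yc') eqxx.
have Yu : Y <> u.
  move=> eY; move: au; rewrite -Xa -(@net_inj b c u X) ?eqxx // 1?eq_sym //.
  by rewrite -eY Yc.
have Ybu : f b Y != f b u by apply/eqP=> e; apply/Yu/(net_inj ab).
exists [:: (a, f a q); (c, f c X); (b, f b Y)].
have onXu v : f b v = f b X -> f c v = f c X -> f a v = f a q.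
  by move=> e1 e2; rewrite -Xa (@net_inj b c v X) // eq_sym.
have covE v : covers [:: (a, f a q); (c, f c X); (b, f b Y)] v =
  (f a v == f a q) (+) (f c v == f c X) (+) (f b v == f b Y).
  by rewrite /covers /= addn0 !oddD !oddb addbA.
have cova v : f a v = f a u -> covers [:: (a, f a q); (c, f c X); (b, f b Y)] v = false.
  move=> va; rewrite covE va (negPf au) /=; case: eqP => [e|ne].
    by rewrite (@net_inj a c v Y) ?eqxx ?va ?e // eq_sym.
  case: eqP => // e; case: ne; rewrite -Yc; congr f; apply: (net_inj ab) => //.
  by rewrite va.
have covb v : f b v = f b u -> covers [:: (a, f a q); (c, f c X); (b, f b Y)] v = false.
  move=> vb; rewrite covE vb [f b u == _]eq_sym (negPf Ybu) addbF; case: eqP => [e|ne].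
    by rewrite (net_inj ab (v := X) (u := v)) ?eqxx ?vb ?e // eq_sym.
  by case: eqP => // e; case: ne; apply: onXu; rewrite // vb.
split.
- rewrite covE eqxx [f b q == _]eq_sym (negPf Yb) addbF; case: eqP => // e.
  by move: bu; rewrite -Xb (@net_inj a c q X) ?eqxx // eq_sym.
- by rewrite cova.
- split=> [l|v _ _]; last by rewrite covers_line; case: eqP => // /cova ->.
  by rewrite !inE => /eqP ->; rewrite !xpair_eqE eqxx (negPf au) (negPf ab) eq_sym (negPf ca).
split=> [l|v _ _]; last by rewrite covers_line; case: eqP => // /covb ->.
rewrite !inE => /eqP ->; rewrite !xpair_eqE eqxx [b == a]eq_sym (negPf ab) [b == c]eq_sym (negPf cb).
by rewrite [f b u == f b Y]eq_sym (negPf Ybu).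
Qed.

(* [m] is a multiset of five requests; one request of each point is served by
   the point itself, the others by the families [Phi q i]. *)
Lemma net_families (m : T -> nat) : \sum_u m u = 5 ->
  exists Phi : T -> nat -> seq ('I_5 * Z),
    (forall q i d, i.+1 < m q -> 0 < m d -> covers (Phi q i) d = (d == q)) /\
    (forall q i q' i', i.+1 < m q -> i'.+1 < m q' -> (q, i) != (q', i') ->
       compatible q q' (Phi q i) (Phi q' i')).
Proof.
move=> m5.
have card_supp (A : {set T}) : #|[set d in A | 0 < m d]| <= \sum_(d in A) m d.
  rewrite -sum1_card [leqRHS](bigID (fun d => 0 < m d)) /=.
  apply: leq_trans (leq_addr _ _).
  by under eq_bigl do rewrite inE; apply: leq_sum => d /andP[].
(* The split is on whether two distinct points are both requested at least twice. If so, the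
   ordering leaves only the multiplicities 2 + 2 + 1 and 2 + 3. *)
case: (pickP (fun pq : T * T => [&& pq.1 != pq.2, 1 < m pq.1 & m pq.1 <= m pq.2])); last first.
  move=> single; case: (pickP (fun q => 1 < m q)) => [q q1|none]; last first.
    exists (fun _ _ => [::]); split=> q i *; last first.
      by have := none q; rewrite (leq_ltn_trans _ (_ : i.+1 < m q)).
    by have := none q; rewrite (leq_ltn_trans _ (_ : i.+1 < m q)).
  have uniq_q d i : i.+1 < m d -> d = q.
    move=> id; have d1 : 1 < m d by apply: leq_ltn_trans id.
    apply/eqP/negP => /negP dq; have := single (d, q); have := single (q, d).
    by rewrite /= q1 d1 dq eq_sym dq /=; case: leqP => // /ltnW ->.
  (* At most [5 - m q] slopes join [q] to another requested point, which leaves enough slopes for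
     the repeated requests of [q]. *)
  pose B := [set s | [exists d in [set d in [set~ q] | 0 < m d], f s d == f s q]].
  have cB : m q <= #|~: B|.
    have := card_supp [set~ q]; under eq_bigl do rewrite !inE.
    have := card_slopes_hitting (A := [set d in [set~ q] | 0 < m d]) (u := q).
    rewrite -/B !inE eqxx => /(_ isT).
    by have := cardsC B; rewrite card_ord; move: m5; rewrite (bigD1 q) //=; lia.
  exists (fun q i => line (nth ord0 (enum (~: B)) i) q).
  have iB i : i.+1 < m q -> i < size (enum (~: B)).
    by move=> iq; rewrite -cardE; apply: leq_trans cB; apply: ltnW.
  split=> [d i e id ed|d i d' i' id id'].
    have dq := uniq_q _ _ id; subst d; rewrite covers_line.
    case: (eqVneq e q) => [->|neq]; first by rewrite eqxx.
    have /[!(mem_enum, inE)] := mem_nth ord0 (iB i id).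
    by move/existsPn/(_ e); rewrite !inE neq ed /= => /negPf.
  have dq := uniq_q _ _ id; have dq' := uniq_q _ _ id'; subst d d' => ne.
  apply: compatible_lines; rewrite nth_uniq ?iB ?enum_uniq //.
  by move: ne; rewrite xpair_eqE eqxx.
case=> p q /= /and3P[qp q1 qle].
have m5' : m p + m q + \sum_(d in ~: [set p; q]) m d = 5.
  move: m5; rewrite (bigD1 p) //= (bigD1 q) /= 1?eq_sym // addnA => <-; congr addn.
  by apply: eq_bigl => d; rewrite !inE negb_or.
have mD d : d != p -> d != q -> m p + m q + m d <= 5.
  move=> dp dq; rewrite -m5' leq_add2l (bigD1 d) ?leq_addr //.
  by rewrite !inE negb_or dp.
(* Requests 3q + 2p: at most one slope joins [p] and [q]. Two of the others give lines through [q],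
   and the triangle serves [p]. *)
have [mp3|mp2] := leqP 3 (m q).
  have qp' : q != p by rewrite eq_sym.
  have onlypq d : 0 < m d -> d = p \/ d = q.
    case: (eqVneq d p) => [|dp]; [by left|case: (eqVneq d q) => [|dq]; [by right|]].
    by have := mD d dp dq; lia.
  have : 1 < #|~: [set s | [exists d in [set p], f s d == f s q]]|.
    have := card_slopes_hitting (A := [set p]) (u := q); rewrite !inE qp' cards1 => /(_ isT).
    by have := cardsC [set s | [exists d in [set p], f s d == f s q]]; rewrite card_ord; lia.
  case/card_gt1P => a [b []]; rewrite !inE => /existsPn/(_ p) + /existsPn/(_ p) + ab.
  rewrite !inE !eqxx /= => ap bp.
  have [||F [Fp Fq Fa Fb]] := @triangle_family a b q p ab; first by rewrite eq_sym.
    by rewrite eq_sym.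
  exists (fun d i => if d == p then F else if i == 0 then line a q else line b q).
  split=> [d i e id /onlypq epq|d i d' i' id id' dd'].
    have [?|?] : d = p \/ d = q by apply: onlypq; lia.
      by subst d; rewrite eqxx; case: epq => ->; rewrite ?Fp ?eqxx // (negPf Fq) (negPf qp').
    subst d; rewrite (negPf qp'); case: epq => ->; case: ifP => _; rewrite covers_line ?eqxx //.
      by rewrite (negPf ap) (negPf qp).
    by rewrite (negPf bp) (negPf qp).
  have [?|?] : d = p \/ d = q by apply: onlypq; lia.
    have [?|?] : d' = p \/ d' = q by apply: onlypq; lia.
      by subst d d'; move: dd'; rewrite xpair_eqE eqxx /=; lia.
    by subst d d'; rewrite eqxx (negPf qp'); case: ifP => _; apply: compatible_sym.
  have [?|?] : d' = p \/ d' = q by apply: onlypq; lia.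
    by subst d d'; rewrite eqxx (negPf qp'); case: ifP => _.
  subst d d'; rewrite (negPf qp'); move: dd'; rewrite xpair_eqE eqxx /=.
  case: ifP => [/eqP ->|i0]; case: ifP => [/eqP ->|i'0] // ii'; try by apply: compatible_lines; rewrite // eq_sym.
  by lia.
(* Two doubled points, with [A] holding the possible fifth request: at most two slopes are bad at
   [p] and one at [q], so some slope gives parallel lines that separate all requested points. *)
pose A := [set d in ~: [set p; q] | 0 < m d].
have cA : #|A| <= 1 by apply: leq_trans (card_supp _) _; lia.
pose Bp := [set s | [exists d in q |: A, f s d == f s p]].
pose Bq := [set s | [exists d in A, f s d == f s q]].
have [s] : exists s, s \in ~: (Bp :|: Bq).
  apply/card_gt0P; have := cardsC (Bp :|: Bq); rewrite card_ord.
  have [+ _] := leq_card_setU Bp Bq.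
  have := card_slopes_hitting (A := q |: A) (u := p).
  have := card_slopes_hitting (A := A) (u := q).
  rewrite -/Bp -/Bq !inE !eqxx (negPf qp) orbT /= => /(_ isT) + /(_ isT).
  by rewrite cardsU1; lia.
rewrite !inE negb_or => /andP[/existsPn sp /existsPn sq].
have sep d e : 1 < m d -> 0 < m e -> (f s e == f s d) = (e == d).
  move=> d1 e1; apply/idP/eqP => [|-> //]; apply: contraTeq => ed.
  have [?|?] : d = p \/ d = q.
      case: (eqVneq d p) => [|dp]; [by left|case: (eqVneq d q) => [|dq]; [by right|]].
      by have := mD d dp dq; lia.
    by subst d; have := sp e; rewrite !inE e1 (negPf ed); case: (eqVneq e q).
  subst d; case: (eqVneq e p) => [->|ep].
    by have := sp q; rewrite !inE eqxx [f s q == _]eq_sym.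
  by have := sq e; rewrite !inE e1 (negPf ed) (negPf ep).
have le2 d : m d <= 2.
  case: (eqVneq d p) => [->|dp]; [lia|case: (eqVneq d q) => [->|dq]; [lia|]].
  by have := mD d dp dq; lia.
exists (fun d _ => line s d); split=> [d i e id e0|d i d' i' id id' dd'].
  by rewrite covers_line sep //; lia.
apply: compatible_parallel; rewrite sep; try lia.
apply: contra dd' => /eqP ->; rewrite xpair_eqE eqxx /=.
by have := le2 d; have := le2 d'; lia.
Qed.
End Net.

(** * Batch codes whose parity checks are the lines of a net *)

Lemma natr_F2 k : k%:R%R = (odd k)%:R%R :> 'F_2.
Proof. by rewrite -Zp_nat_mod // modn2. Qed.

Section NetCode.

Local Open Scope ring_scope.

Variables (T Z : finType) (f : 'I_5 -> T -> Z).

Hypothesis net_inj : forall s t u v,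
  s != t -> f s u = f s v -> f t u = f t v -> u = v.
Hypothesis net_ex : forall s t x y, s != t -> exists u, f s u = x /\ f t u = y.

Variables (n N : nat) (G : 'M['F_2]_(n, N)) (h : 'I_n -> T).
Variables (info : 'I_n -> 'I_N) (parity : 'I_5 * Z -> 'I_N).

Hypothesis h_inj : injective h.
Hypothesis info_inj : injective info.
Hypothesis parity_inj : injective parity.
Hypothesis info_parity : forall a l, info a != parity l.
Hypothesis infoE : forall a b, G a (info b) = (a == b)%:R.
Hypothesis parityE : forall a l, G a (parity l) = (f l.1 (h a) == l.2)%:R.

(** The exclusive or treats both uses at once: a family covering [q] reads the other covered bits,
    and the empty family reads [q] itself. *)
Definition recovery_bits (F : seq ('I_5 * Z)) (q : 'I_n) : {set 'I_n} :=
  [set a | covers f F (h a) (+) (a == q)].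

Definition recovery_set (F : seq ('I_5 * Z)) (q : 'I_n) : {set 'I_N} :=
  info @: recovery_bits F q :|: parity @: [set l in F].

(** By linearity, consider a difference [z] whose codeword vanishes on the set. Either [q] is read
    directly, or the sum of the parities in [F] reduces to [z 0 q]. *)
Lemma recovery_set_recovers F q : recovers G (recovery_set F q) q.
Proof.
move=> x y xy; pose z := x - y.
have zc c : c \in recovery_set F q -> (z *m G) 0 c = 0.
  by move=> cR; rewrite mulmxBl mxE (xy c cR) [X in _ + X]mxE subrr.
have zinfo a : (z *m G) 0 (info a) = z 0 a.
  rewrite mxE (bigD1 a) //= infoE eqxx mulr1 big1 ?addr0 // => b ba.
  by rewrite infoE (negPf ba) mulr0.
have z0 a : a \in recovery_bits F q -> z 0 a = 0.
  by move=> aA; rewrite -zinfo zc // inE imset_f.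
have : \sum_(l <- F) (z *m G) 0 (parity l) = 0.
  rewrite big_seq big1 // => l lF; rewrite zc // inE; apply/orP; right.
  by rewrite imset_f ?inE.
have coverE a : \sum_(l <- F) z 0 a * G a (parity l) = z 0 a * (covers f F (h a))%:R.
  under eq_bigr do rewrite parityE.
  by rewrite -mulr_sumr -natr_sum natr_F2 /covers -sumn_count sumnE big_map.
under eq_bigr do rewrite mxE.
rewrite exchange_big (bigD1 q) //= [X in _ + X]big1 ?addr0 => [|a aq]; rewrite coverE.
  have : z 0 q = 0 -> x 0 q = y 0 q by rewrite !mxE => /eqP; rewrite subr_eq0 => /eqP.
  move=> zq; case: (boolP (covers f F (h q))) => cq; first by rewrite mulr1.
  by move=> _; apply/zq/z0; rewrite inE (negPf cq) eqxx.
case: (boolP (covers f F (h a))) => ca; last by rewrite mulr0.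
by rewrite z0 ?mul0r // inE ca (negPf aq).
Qed.

Lemma recovery_set_disjoint F F' q q' :
  (forall l, l \in F -> l \notin F') ->
  (forall a, ~~ ((a \in recovery_bits F q) && (a \in recovery_bits F' q'))) ->
  [disjoint recovery_set F q & recovery_set F' q'].
Proof.
move=> FF' bits; rewrite -setI_eq0; apply/eqP/setP => c; rewrite !inE.
apply/negP => /andP[/orP[] /imsetP[x xF ->] /orP[] /imsetP[y yF]].
- by move/info_inj => e; subst y; have := bits x; rewrite xF yF.
- by move/eqP; rewrite (negPf (info_parity _ _)).
- by move/esym/eqP; rewrite (negPf (info_parity _ _)).
- by move/parity_inj => e; subst y; move: xF yF; rewrite !inE => /FF' /negPf ->.
Qed.

Lemma net_code_batch : batch_code 5 G.
Proof.
split.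
  apply/eqP/row_freeP; exists (\matrix_(c, b) (c == info b)%:R).
  apply/matrixP => a b; rewrite !mxE (bigD1 (info b)) //= big1 => [|c cb].
    by rewrite infoE mxE eqxx mulr1 addr0.
  by rewrite mxE (negPf cb) mulr0.
move=> req; pose m u := #|[set j | h (req j) == u]|.
have m5 : (\sum_u m u = 5)%N.
  rewrite -[RHS]card_ord -sum1_card (partition_big (h \o req) predT) //=.
  by apply: eq_bigr => u _; rewrite /m -sum1_card; apply: eq_bigl => j; rewrite inE.
have [Phi [PhiD PhiC]] := net_families net_inj net_ex m5.
(* The size of [before j] ranks [j] among the requests for the same bit: rank 0 reads the bit
   itself, and rank [i.+1] uses the family of index [i]. *)
pose before (j : 'I_5) := [set j' : 'I_5 | (j' < j)%N && (req j' == req j)].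
have rank_lt j : (#|before j| < m (h (req j)))%N.
  apply: proper_card; apply/properP; split.
    by apply/subsetP => j'; rewrite !inE => /andP[_ /eqP ->].
  by exists j; rewrite !inE ?eqxx ?ltnn.
have rank_inj (j j' : 'I_5) : req j = req j' -> #|before j| = #|before j'| -> j = j'.
  wlog jj' : j j' / (j <= j')%N => [wl e e'|e e'].
    by case/orP: (leq_total j j') => /wl; [apply|move/(_ (esym e) (esym e'))].
  apply/val_inj/eqP; rewrite eqn_leq jj' /= leqNgt; apply/negP => lt.
  have : before j \proper before j'.
    apply/properP; split; last by exists j; rewrite !inE ?ltnn // lt e eqxx.
    by apply/subsetP => i; rewrite !inE => /andP[ij /eqP ->]; rewrite e eqxx (ltn_trans ij lt).
  by move/proper_card; rewrite e' ltnn.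
pose F (j : 'I_5) := if #|before j| is i.+1 then Phi (h (req j)) i else [::].
have m_gt0 j : (0 < m (h (req j)))%N by apply: leq_ltn_trans (rank_lt j).
exists (fun j => recovery_set (F j) (req j)); split=> [j j' jj'|j]; last exact: recovery_set_recovers.
have bits0 q a : (a \in recovery_bits [::] q) = (a == q) by rewrite inE.
have bitsPhi q i j0 : (i.+1 < m (h q))%N -> (req j0 \in recovery_bits (Phi (h q) i) q) = false.
  by move=> im; rewrite inE PhiD // (inj_eq h_inj) addbb.
have := rank_lt j; have := rank_lt j'; have := @rank_inj j j'; rewrite /F.
case: #|before j| => [|i]; case: #|before j'| => [|i'] inj' im' im; apply: recovery_set_disjoint => //.
- by move=> a; rewrite !bits0; apply: contra jj' => /andP[/eqP -> /eqP e]; rewrite inj'.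
- by move=> a; rewrite bits0; case: eqP => //= ->; rewrite bitsPhi.
- by move=> a; rewrite bits0 andbC; case: eqP => //= ->; rewrite bitsPhi.
- have ne : (h (req j), i) != (h (req j'), i').
    by apply: contra jj' => /eqP[/h_inj e ii']; rewrite inj' // ii'.
  by have [] := PhiC _ _ _ _ im im' ne.
move=> a.
have ne : (h (req j), i) != (h (req j'), i').
  by apply: contra jj' => /eqP[/h_inj e ii']; rewrite inj' // ii'.
case: (eqVneq a (req j)) => [->|aj]; first by rewrite bitsPhi.
case: (eqVneq a (req j')) => [->|aj']; first by rewrite [X in _ && X]bitsPhi ?andbF.
rewrite !inE (negPf aj) (negPf aj') !addbF.
by have [_] := PhiC _ _ _ _ im im' ne; apply; rewrite (inj_eq h_inj).
Qed.

End NetCode.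

(** * The net of slopes over the integers modulo an integer coprime to 6 *)

Section SlopeNet.

Local Open Scope ring_scope.

Variable k : nat.
Local Notation Zp := 'I_k.+2.

Hypothesis k_coprime6 : coprime k.+2 6.

Definition slope_index (s : 'I_5) (u : Zp * Zp) : Zp := u.2 - s%:R * u.1.

(** Up to sign the difference is 1, 2, 3 or 4, whose only prime factors are 2 and 3. *)
Lemma slope_sub_unit (s t : 'I_5) : s != t -> (s%:R - t%:R : Zp) \is a GRing.unit.
Proof.
wlog st : s t / (s < t)%N => [wl ne|_].
  case: (ltnP s t) => [lt|le]; first exact: wl.
  rewrite -opprB unitrN wl // 1?eq_sym // ltn_neqAle le andbT.
  by apply: contra ne => /eqP /val_inj ->.
rewrite -opprB unitrN -natrB 1?ltnW // (@unitZpE k.+2) //.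
have cop d : (0 < d < 5)%N -> coprime k.+2 d.
  have [c2 c3] : coprime k.+2 2 /\ coprime k.+2 3.
    by apply/andP; rewrite -coprimeMr.
  by case: d => [|[|[|[|[|d]]]]] // _; rewrite ?coprimen1 // -[4%N]/(2 * 2)%N coprimeMr c2.
by apply: cop; have := ltn_ord t; lia.
Qed.

Lemma slope_net_inj (s t : 'I_5) u v : s != t ->
  slope_index s u = slope_index s v -> slope_index t u = slope_index t v -> u = v.
Proof.
case: u v => [i j] [i' j'] /slope_sub_unit st; rewrite /slope_index /= => es et.
have ii' : i = i'.
  apply: (mulrI st); apply/eqP; rewrite -subr_eq0; apply/eqP.
  transitivity ((j - t%:R * i) - (j' - t%:R * i') - ((j - s%:R * i) - (j' - s%:R * i'))); first by ring.
  by rewrite es et !subrr.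
by subst i'; rewrite (addIr _ es).
Qed.

Lemma slope_net_ex (s t : 'I_5) x y : s != t ->
  exists u, slope_index s u = x /\ slope_index t u = y.
Proof.
move=> /slope_sub_unit st; pose i := (s%:R - t%:R)^-1 * (y - x).
exists (i, x + s%:R * i); rewrite /slope_index /=; split; first by ring.
transitivity (x + (s%:R - t%:R) * i); first by ring.
by rewrite /i mulVKr //; ring.
Qed.

End SlopeNet.

(** * The array code and its shortenings *)

Section ArrayCode.

Local Open Scope ring_scope.

Lemma in_D_slope_index (k s i : nat) (j t : 'I_k.+2) :
  in_D k.+2 s t i j = (j - s%:R * i%:R == t).
Proof.
rewrite /in_D subr_eq -natrM -{2}[t]natr_Zp -natrD. rewrite Zp_nat -val_eqE /=.
by rewrite mulnC.
Qed.

(** Only the first [n + 5 * p] columns are prescribed, so the result covers both the code with a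
    global parity bit and the codes shortened to [n <= p * p] bits. *)
Lemma array_code_batch (p n N : nat) (G : 'M['F_2]_(n, N)) :
  (1 < p)%N -> coprime p 6 -> (n <= p * p)%N -> (n + 5 * p <= N)%N ->
  (forall a (c : 'I_N), (c < n)%N -> G a c = (a == c :> nat)%:R) ->
  (forall (a : 'I_n) (c : 'I_N) l t, (l < 5)%N -> (t < p)%N -> (c = n + l * p + t :> nat)%N ->
    G a c = (in_D p l t (a %/ p) (a %% p))%:R) ->
  batch_code 5 G.
Proof.
case: p => [|[|k]] // _ kp6 npp nN Ginfo Gpar.
have ltN (l : 'I_5 * 'I_k.+2) : (n + l.1 * k.+2 + l.2 < N)%N.
  case: l => [[l l5] [t tp]] /=; apply: leq_trans nN; rewrite -addnA ltn_add2l.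
  apply: leq_trans (_ : l.+1 * k.+2 <= _)%N; last by rewrite leq_mul2r l5 orbT.
  by rewrite mulSn addnC ltn_add2r.
have leN : (n <= N)%N by apply: leq_trans nN; apply: leq_addr.
pose h (a : 'I_n) : 'I_k.+2 * 'I_k.+2 := (inZp (a %/ k.+2), inZp (a %% k.+2)).
have vh a : (val (h a).1 = a %/ k.+2)%N /\ (val (h a).2 = a %% k.+2)%N.
  by rewrite /= modn_mod modn_small // ltn_divLR // (leq_trans (ltn_ord a)).
apply: (@net_code_batch _ _ (@slope_index k) _ _ n N G h (widen_ord leN) (fun l => Ordinal (ltN l))).
- exact: slope_net_inj.
- exact: slope_net_ex.
- move=> a b ab; apply: val_inj => /=.
  rewrite (divn_eq a k.+2) (divn_eq b k.+2).
  by have [<- <-] := vh a; have [<- <-] := vh b; rewrite ab.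
- by move=> a b /(congr1 val) /= /val_inj.
- move=> [l t] [l' t'] /(congr1 val) /= e.
  have et : t = t'.
    move/eqP: e; rewrite -!addnA eqn_add2l => /eqP /(congr1 (modn^~ k.+2)).
    by rewrite !modnMDl !modn_small // => /val_inj.
  subst t'; congr pair; apply: val_inj; apply/eqP.
  by move/eqP: e; rewrite eqn_add2r eqn_add2l eqn_mul2r.
- move=> a l; apply/eqP => /(congr1 val) /= e.
  by have := ltn_ord a; rewrite e -addnA -ltn_subRL subnn.
- by move=> a b; rewrite (Ginfo a (widen_ord leN b) (ltn_ord b)).
move=> a [l t]; rewrite (Gpar a _ l t) //.
have [_ e2] := vh a; have e1 : (h a).1 = (a %/ k.+2)%:R by rewrite Zp_nat.
by rewrite -e2 in_D_slope_index -e1.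
Qed.

Lemma batchG_batch (p : nat) : (1 < p)%N -> coprime p 6 -> batch_code 5 (batchG p).
Proof.
move=> p1 p6; apply: (array_code_batch p1 p6 (leqnn _)); first exact: leq_addr.
  by move=> a c cn; rewrite mxE cn; case: eqP.
move=> a c l t l5 tp e; rewrite mxE ltnNge e -addnA leq_addr /= ltn_add2l.
have -> : (l * p + t < 5 * p)%N.
  apply: leq_trans (_ : l.+1 * p <= _)%N; last by rewrite leq_mul2r l5 orbT.
  by rewrite mulSn addnC ltn_add2r.
rewrite addKn divnMDl ?(ltnW p1) // divn_small // addn0 modnMDl modn_small //.
by case: in_D.
Qed.

Lemma achievable_array (p n : nat) : (1 < p)%N -> coprime p 6 -> (n <= p * p)%N ->
  achievable_redundancy n 5 (5 * p).
Proof.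
move=> p1 p6 npp.
exists (\matrix_(a < n, c < n + 5 * p) if (c < n)%N then (a == c :> nat)%:R
  else (in_D p ((c - n) %/ p) ((c - n) %% p) (a %/ p) (a %% p))%:R).
apply: (array_code_batch p1 p6 npp (leqnn _)) => [a c cn|a c l t l5 tp e].
  by rewrite mxE cn.
rewrite mxE ltnNge e -addnA leq_addr /= addKn divnMDl ?(ltnW p1) //.
by rewrite divn_small // addn0 modnMDl modn_small.
Qed.

End ArrayCode.

(** * Lower bound from products of dual codewords *)

Section LowerBound.

Local Open Scope ring_scope.

(** An arbitrary recovery function can be replaced by a linear one: coordinate [i] vanishes on every
    information vector whose codeword is zero on [R], hence is a combination of the columns of [G]
    indexed by [R]. *)
Lemma recovers_linear n N (G : 'M['F_2]_(n, N)) (R : {set 'I_N}) (i : 'I_n) :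
  recovers G R i ->
  exists u : 'rV['F_2]_N, (forall c, c \notin R -> u 0 c = 0) /\ u *m G^T = delta_mx 0 i.
Proof.
move=> rec; pose H : 'M['F_2]_(N, n) := \matrix_(c, a) (G a c *+ (c \in R)).
have : ((delta_mx 0 i : 'rV_n) <= H)%MS.
  rewrite submxE -rowE; apply/eqP/rowP => j; rewrite !mxE.
  have := rec (col j (cokermx H))^T 0; rewrite !mxE; apply => c cR.
  rewrite mul0mx mxE [RHS]mxE -[RHS](_ : (H *m cokermx H) c j = _); last by rewrite mulmx_coker mxE.
  by rewrite !mxE; apply: eq_bigr => a _; rewrite !mxE cR mulrC.
case/submxP => D dE; exists (\row_c (D 0 c *+ (c \in R))); split=> [c /negPf cR|].
  by rewrite mxE cR.
rewrite dE; apply/rowP => a; rewrite !mxE; apply: eq_bigr => c _; rewrite !mxE.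
by case: (c \in R); rewrite ?mulr0n ?mul0r ?mulr0.
Qed.

Definition hadamard (F : fieldType) N (u v : 'rV[F]_N) : 'rV[F]_N := map2_mx *%R u v.

Lemma hadamard_sub (F : fieldType) (r N : nat) (K : 'M[F]_(r, N)) (u v : 'rV_N) :
  (u <= K)%MS -> (v <= K)%MS ->
  (hadamard u v <= \sum_(st : 'I_r * 'I_r) <<hadamard (row st.1 K) (row st.2 K)>>)%MS.
Proof.
case/submxP => A -> /submxP[B ->].
have -> : hadamard (A *m K) (B *m K) =
    \sum_(st : 'I_r * 'I_r) (A 0 st.1 * B 0 st.2) *: hadamard (row st.1 K) (row st.2 K).
  apply/rowP => c; rewrite !mxE summxE big_distrlr pair_big /=.
  by apply: eq_bigr => st _; rewrite !mxE mulrACA.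
apply: summx_sub => st _; apply: scalemx_sub; apply: (sumsmx_sup st) => //.
by rewrite genmxE.
Qed.

Lemma batch_redundancy_lower k n r (G : 'M['F_2]_(n, n + r)) :
  (2 < k)%N -> batch_code k G -> (n <= r * r)%N.
Proof.
move=> k2 [rkG batch]; set N := (n + r)%N in G rkG batch *.
pose K := row_base (kermx G^T).
have rkK : \rank (kermx G^T) = r by rewrite mxrank_ker mxrank_tr rkG addKn.
pose S := (\sum_(st : 'I__ * 'I__) <<hadamard (row st.1 K) (row st.2 K)>>)%MS.
have rec i : exists u : 'rV['F_2]_N, u *m G^T = delta_mx 0 i /\ (u <= S)%MS.
  have [R [disj recR]] := batch (fun=> i).
  pose o j (jk : (j < 3)%N) : 'I_k := Ordinal (leq_trans jk k2).
  have [u1 [s1 e1]] := recovers_linear (recR (o 0%N isT)).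
  have [u2 [s2 e2]] := recovers_linear (recR (o 1%N isT)).
  have [u3 [s3 e3]] := recovers_linear (recR (o 2%N isT)).
  exists u1; split=> //.
  have dual (v : 'rV_N) : v *m G^T = delta_mx 0 i -> (u1 - v <= K)%MS.
    by move=> ev; rewrite eq_row_base; apply/sub_kermxP; rewrite mulmxBl e1 ev subrr.
  (* In the expanded product the mixed terms vanish by disjointness of supports, and [u1] is its own
     square over F_2. *)
  suff -> : u1 = hadamard (u1 - u2) (u1 - u3) by apply: hadamard_sub; apply: dual.
  have prod0 (v w : 'rV['F_2]_N) j j' : j != j' -> (forall c, c \notin R j -> v 0 c = 0) ->
      (forall c, c \notin R j' -> w 0 c = 0) -> forall c, v 0 c * w 0 c = 0.
    move=> jj' vj wj' c; case: (boolP (c \in R j)) => cj; last by rewrite vj ?mul0r.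
    by rewrite wj' ?mulr0 // (disjointFr (disj _ _ jj') cj).
  have idem (x : 'F_2) : x * x = x by apply: val_inj; case: x => [[|[]]].
  apply/rowP => c; rewrite !mxE mulrBl !mulrBr idem.
  by rewrite (prod0 _ _ _ _ _ s1 s3) ?(prod0 _ _ _ _ _ s2 s1) ?(prod0 _ _ _ _ _ s2 s3) ?subr0.
have /(_ _)/cid u_ := rec.
pose U : 'M['F_2]_(n, N) := \matrix_i (sval (u_ i)).
have rkU : \rank U = n.
  apply/eqP/row_freeP; exists G^T; apply/row_matrixP => i.
  by rewrite row_mul rowK row1; case: (svalP (u_ i)).
have US : (U <= S)%MS.
  by apply/row_subP => i; rewrite rowK; case: (svalP (u_ i)).
(* Each of the [r * r] summands of [S] is spanned by one vector. *)
rewrite -{1}rkU; apply: leq_trans (mxrankS US) _.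
apply: leq_trans (mxrank_sum_leqif _).1 _.
apply: leq_trans (_ : \sum_(st : 'I_(\rank (kermx G^T)) * 'I_(\rank (kermx G^T))) 1 <= _)%N.
  by apply: leq_sum => st _; rewrite /= genmxE rank_leq_row.
by rewrite sum1_card card_prod card_ord rkK.
Qed.

End LowerBound.

(** * The order of growth of the minimum redundancy *)

Lemma rBP n k r : achievable_redundancy n k r -> achievable_redundancy n k (rB n k) /\ rB n k <= r.
Proof.
move=> ach; rewrite /rB; case: pselect => [ex|[]]; last by exists r; apply/asboolP.
by case: ex_minnP => m /asboolP achm minm; split=> //; apply/minm/asboolP.
Qed.

(** The least [p] of the form 6k + 7 with large enough square works: it is 1 modulo 6, and
    minimality bounds it. The constant 49 is attained at [n = 1], where [p = 7]. *)
Lemma coprime6_square_above n : 0 < n ->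
  exists p, [/\ 1 < p, coprime p 6, n <= p * p & p * p <= 49 * n].
Proof.
move=> n0; have ex : exists k, n <= (6 * k + 7) * (6 * k + 7) by exists n; nia.
have [k nk mink] := ex_minnP ex; exists (6 * k + 7); split=> //; first by lia.
  by rewrite -coprime_modl mulnC modnMDl.
case: k nk mink => [|k] nk mink; first by nia.
have : ~~ (n <= (6 * k + 7) * (6 * k + 7)) by apply/negP => /mink; rewrite ltnn.
by nia.
Qed.

Lemma rB5_Theta_sqrt : Theta_sqrt (fun n => rB n 5).
Proof.
(* The constant 35 is 5 times 7, since the redundancy [5 * p] is available with [p] at most 7 times
   the square root of [n]. *)
exists 1%R, 35%:R%R; rewrite ltr01 ltr0n; do 2!split=> //; exists 1 => n n0.
have [p [p1 p6 npp ppn]] := coprime6_square_above n0.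
have [[G /(batch_redundancy_lower (isT : 2 < 5)) low] up] := rBP (achievable_array p1 p6 npp).
split.
  rewrite mul1r -[leRHS]ger0_norm ?ler0n // -sqrtr_sqr ler_wsqrtr // -natrX ler_nat.
  by rewrite -mulnn.
apply: le_trans (_ : (5 * p)%:R <= _)%R; first by rewrite ler_nat.
rewrite -[leLHS]ger0_norm ?ler0n // -sqrtr_sqr -[X in (X * _)%R]ger0_norm ?ler0n //.
rewrite -[X in (X * _)%R]sqrtr_sqr -sqrtrM ?sqr_ge0 // ler_wsqrtr //.
by rewrite -!natrX -natrM ler_nat; nia.
Qed.

Theorem theorem13 (p : nat) (p_prime : prime p) (p_ge5 : (5 <= p)%N) :
  batch_code 5 (batchG p)
  /\ ((p * p + 5 * p + 1) - p * p = 5 * p + 1)%N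
  /\ Theta_sqrt (fun n => rB n 5).
Proof.
split; last by split; [lia|exact: rB5_Theta_sqrt].
apply: batchG_batch; first exact: prime_gt1.
rewrite (coprimeMr p 2 3) !prime_coprime //.
by apply/andP; split; apply/negP => /dvdn_leq; lia.
Qed.
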